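(* For all integers $n\ge 1$ and $0\le i\le \lfloor n/2\rfloor$, $$A_{n,i}(q) = \sum_{k=i}^{\lfloor n/2 \rfloor} f_{(n-k,k),i}(q) \cdot \binom{n}{k} \frac{n-2k+1}{n-k+1}.$$
   Context: $\mathcal{S}_n(321)$ is the set of permutations $\sigma=(\sigma_1,\dots,\sigma_n)$ of $\{1,\dots,n\}$ having no indices $a<b<c$ with $\sigma_a>\sigma_b>\sigma_c$. For a permutation, $\mathrm{Des}(\sigma)=\{j:\sigma_j>\sigma_{j+1}\}$, $\mathrm{des}(\sigma)=|\mathrm{Des}(\sigma)|$, $\mathrm{maj}(\sigma)=\sum_{j\in\mathrm{Des}(\sigma)} j$. The polynomials $A_{n,i}(q)$ are defined by $\sum_{\sigma\in\mathcal{S}_n(321)} q^{\mathrm{maj}(\sigma)}t^{\mathrm{des}(\sigma)}=\sum_{i=0}^{\lfloor n/2\rfloor}A_{n,i}(q)t^i$, i.e. $A_{n,i}(q)$ is the sum of $q^{\mathrm{maj}(\sigma)}$ over $\sigma\in\mathcal{S}_n(321)$ with exactly $i$ descents. For a partition $\lambda$ of $n$, $SYT(\lambda)$ is the set of standard Young tableaux of shape $\lambda$ (fillings of the Ferrers diagram, with row 1 on top, by $1,\dots,n$, increasing along rows to the right and down columns). For a tableau $T$, $\mathrm{Des}(T)$ is the set of $j\in\{1,\dots,n-1\}$ such that $j$ lies in a strictly higher row than $j+1$, and $\mathrm{maj}(T)=\sum_{j\in\mathrm{Des}(T)}j$. Finally $f_{(n-k,k),i}(q)=\sum q^{\mathrm{maj}(T)}$,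 summed over $T\in SYT((n-k,k))$ with $|\mathrm{Des}(T)|=i$; for $k=0$ the shape $(n,0)$ means the one-row shape $(n)$. *)

(* Defs.v *)
From mathcomp Require Import all_boot all_order all_fingroup all_algebra.
Set Implicit Arguments.
Unset Strict Implicit.
Unset Printing Implicit Defensive.
Import Order.TTheory GRing.Theory Num.Theory.
Local Open Scope nat_scope.

(* Conventions: the positions and values 1, ..., n of a permutation, and the  *)
(* entries 1, ..., n of a tableau, are represented by the ordinals            *)
(* 0, ..., n-1 of 'I_n. The descents, in contrast, are NOT shifted: they are  *)
(* the j : 'I_n whose value is literally the descent 1 <= j <= n-1, so that   *)
(* maj is the plain sum of the elements of the descent set.                   *)

Definition S321 (n : nat) : {set 'S_n} :=
  [set s : 'S_n | [forall a : 'I_n, forall b : 'I_n, forall c : 'I_n,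
     ~~ [&& a < b, b < c, s b < s a & s c < s b]]].

(* The j-th position is the ordinal a with a.+1 = j, and the (j+1)-st         *)
(* position is j itself.                                                      *)
Definition perm_Des (n : nat) (s : 'S_n) : {set 'I_n} :=
  [set j : 'I_n | [exists a : 'I_n, (a.+1 == j :> nat) && (s j < s a)]].

Definition perm_des (n : nat) (s : 'S_n) : nat := #|perm_Des s|.

Definition perm_maj (n : nat) (s : 'S_n) : nat := \sum_(j in perm_Des s) j.

(* The cells of the Ferrers diagram of la = [:: la_1; la_2; ...], row 0 being *)
(* the top row. A null part contributes no cell.                              *)
Notation cell la := {r : 'I_(size la) & 'I_(nth 0%N la r)}.

Definition cell_row (la : seq nat) (c : cell la) : nat := tag c.
Definition cell_col (la : seq nat) (c : cell la) : nat := tagged c.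

Notation filling n la := {ffun cell la -> 'I_n}.

(* Each of the n entries is used exactly once, so this set is empty unless    *)
(* the diagram la has exactly n cells.                                        *)
Definition SYT (n : nat) (la : seq nat) : {set filling n la} :=
  [set T : filling n la |
    [&& injectiveb T,
        [forall j : 'I_n, exists c : cell la, T c == j],
        [forall c : cell la, forall d : cell la,
           (cell_row c == cell_row d) && (cell_col c < cell_col d)
             ==> (T c < T d)]
      & [forall c : cell la, forall d : cell la,
           (cell_col c == cell_col d) && (cell_row c < cell_row d)
             ==> (T c < T d)]]].

(* The entry j is the ordinal with successor j, and the entry j+1 is j.       *)
Definition tab_Des (n : nat) (la : seq nat) (T : filling n la) : {set 'I_n} :=
  [set j : 'I_n | [exists c : cell la, exists d : cell la,
     [&& (T c).+1 == j :> nat, T d == j & cell_row c < cell_row d]]].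

Definition tab_des (n : nat) (la : seq nat) (T : filling n la) : nat :=
  #|tab_Des T|.

Definition tab_maj (n : nat) (la : seq nat) (T : filling n la) : nat :=
  \sum_(j in tab_Des T) j.

Local Open Scope ring_scope.

Definition A_poly (n i : nat) : {poly rat} :=
  \sum_(s in S321 n | perm_des s == i) 'X^(perm_maj s).

Definition f_poly (n : nat) (la : seq nat) (i : nat) : {poly rat} :=
  \sum_(T in SYT n la | tab_des T == i) 'X^(tab_maj T).

(* Main.v *)
Require Import Defs.
From mathcomp Require Import all_boot all_order all_fingroup all_algebra.
From mathcomp Require Import zify ring.
Import Order.TTheory GRing.Theory Num.Theory.
Set Implicit Arguments.
Unset Strict Implicit.
Unset Printing Implicit Defensive.
Local Open Scope nat_scope.

(* Both sides satisfy the same recursion, which avoids RSK.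
   Give each descent at j a weight x_j, so that inclusion-exclusion on the last
   position applies. A 321-avoiding permutation of size n is extended by a last
   value, which has to lie above every entry that has a larger entry to its
   left; let h be the number of values below the maximal one n + 1 that remain
   available. With E e_h = e_1 + ... + e_h and U e_h = e_(h+1), the weighted
   distribution X_n of h satisfies
     X_(n+2) = (U + E) X_(n+1) + (x_(n+1) - 1) E U X_n.
   Two-row tableaux, read as ballot words, satisfy in the same way
     Y_(n+2) = (U + D) Y_(n+1) + (x_(n+1) - 1) D U Y_n
   with D e_d = e_(d-1) on the difference d of the row lengths, where D U = 1.
   Since S = E U commutes with U + E, a functional phi on the h side
   corresponds to (S^k phi)(n - 2k) at the shape (n - k, k); for phi = 1 this is
   the ballot number C(n,k) - C(n,k-1). *)

(** * Extending a 321-avoiding permutation by a last value *)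

(** The successor makes [inv_bound s <= v] the exact condition for [v] to be an admissible last
    value; without inversions the empty maximum 0 admits every [v]. *)
Definition inv_bound n (s : 'S_n) : nat :=
  \max_(b : 'I_n | [exists a : 'I_n, (a < b) && (s b < s a)]) (s b).+1.

Lemma ltn_inv_bound n (s : 'S_n) (a b : 'I_n) :
  a < b -> s b < s a -> s b < inv_bound s.
Proof.
move=> ab sab; rewrite /inv_bound.
by apply: (bigop.bigmax_sup b) => //; apply/existsP; exists a; rewrite ab.
Qed.

Lemma inv_bound_leq n (s : 'S_n) (m : nat) :
  reflect (forall a b : 'I_n, a < b -> s b < s a -> s b < m) (inv_bound s <= m).
Proof.
apply: (iffP idP) => [le_m a b ab sab | H].
  exact: leq_trans (ltn_inv_bound ab sab) le_m.
by apply/bigop.bigmax_leqP => b /existsP[a /andP[ab sab]]; apply: H ab sab.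
Qed.

Lemma inv_bound_le n (s : 'S_n) : inv_bound s <= n.
Proof. exact/inv_bound_leq. Qed.

Lemma S321P n (s : 'S_n) :
  reflect (forall a b c : 'I_n, a < b -> b < c -> s b < s a -> ~~ (s c < s b))
          (s \in S321 n).
Proof.
rewrite inE; apply: (iffP idP) => [H a b c ab bc sab | H].
  have /forallP/(_ b)/forallP/(_ c) := forallP H a.
  by rewrite ab bc sab.
apply/forallP=> a; apply/forallP=> b; apply/forallP=> c.
apply/negP=> /and4P[ab bc sab sbc].
by have := H a b c ab bc sab; rewrite sbc.
Qed.

(** Entries of [s] that are at least [v] are raised by one to make room for [v], so their relative
    order is kept. *)
Definition append_val n (s : 'S_n) (v : 'I_n.+1) : 'S_n.+1 :=
  lift_perm ord_max v s.

Lemma append_val_max n (s : 'S_n) v : append_val s v ord_max = v.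
Proof. exact: lift_perm_id. Qed.

Lemma append_val_lift n (s : 'S_n) v (a : 'I_n) :
  append_val s v (lift ord_max a) = bump v (s a) :> nat.
Proof. by rewrite /append_val lift_perm_lift. Qed.

Lemma ltn_bump2 h i j : (bump h i < bump h j) = (i < j).
Proof. by rewrite !ltnNge leq_bump2. Qed.

Lemma ltn_bump_self h i : (h < bump h i) = (h <= i).
Proof. rewrite /bump; case: leqP; lia. Qed.

Lemma append_val_bij n :
  bijective (fun sv : 'S_n * 'I_n.+1 => append_val sv.1 sv.2).
Proof.
apply: inj_card_bij => [[s v] [s' v'] /= E|].
  have Ev : v = v' by rewrite -(append_val_max s v) E append_val_max.
  rewrite -Ev in E *; congr pair; apply/permP=> a.
  have /(congr1 (fun p : 'S_n.+1 => p (lift ord_max a))) := E.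
  by rewrite /append_val !lift_perm_lift => /lift_inj.
by rewrite card_prod !card_Sn card_ord factS mulnC.
Qed.

(** A new 321 pattern ends in the last position, and its middle entry is an entry of [s], at least
    [v], that has a larger entry to its left. *)
Lemma append_val_S321 n (s : 'S_n) v :
  (append_val s v \in S321 n.+1) = (s \in S321 n) && (inv_bound s <= v).
Proof.
apply/S321P/andP=> [H | [/S321P Hs /inv_bound_leq Hv] a b c].
  split.
    apply/S321P=> a b c ab bc sab.
    have := H (lift ord_max a) (lift ord_max b) (lift ord_max c).
    by rewrite !lift_max !append_val_lift !ltn_bump2; apply.
  apply/inv_bound_leq => a b ab sab.
  have := H (lift ord_max a) (lift ord_max b) ord_max.
  rewrite !lift_max !append_val_lift append_val_max ltn_bump2 ltn_bump_self.
  by rewrite -ltnNge; apply.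
have ltm (x : 'I_n.+1) : (@ord_max n < x) = false.
  by apply/negbTE; rewrite -leqNgt -ltnS ltn_ord.
case: (unliftP ord_max a) => [{}a ->|->]; last by rewrite ltm.
case: (unliftP ord_max b) => [{}b ->|->]; last by move=> _; rewrite ltm.
rewrite !lift_max => ab.
case: (unliftP ord_max c) => [{}c ->|-> _].
  rewrite !lift_max !append_val_lift !ltn_bump2 => bc; exact: Hs.
rewrite !append_val_lift append_val_max ltn_bump2 ltn_bump_self -ltnNge.
exact: Hv.
Qed.

(** The old inversion bottoms lie below [v] and so are not shifted. A maximal [v] creates no
    inversion; any other [v] becomes the largest inversion bottom itself. *)
Lemma inv_bound_append n (s : 'S_n) (v : 'I_n.+1) : inv_bound s <= v ->
  inv_bound (append_val s v) = if v == ord_max then inv_bound s else v.+1.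
Proof.
move=> le_v.
have lift_lt (a : 'I_n) : lift ord_max a < @ord_max n by rewrite lift_max /=.
have small (a b : 'I_n) : a < b -> s b < s a -> bump v (s b) = s b.
  move=> ab sab; have := leq_trans (ltn_inv_bound ab sab) le_v.
  by rewrite /bump ltnNge => /negbTE->.
have ltm (x : 'I_n.+1) : (@ord_max n < x) = false.
  by apply/negbTE; rewrite -leqNgt -ltnS ltn_ord.
apply/eqP; rewrite eqn_leq; apply/andP; split.
  apply/inv_bound_leq => a b.
  case: (unliftP ord_max a) => [{}a ->|->]; last by rewrite ltm.
  case: (unliftP ord_max b) => [{}b ->|-> _].
    rewrite !lift_max !append_val_lift ltn_bump2 => ab sab.
    rewrite (small a) //; have lt_b := ltn_inv_bound ab sab.
    by case: ifP => // _; apply: leq_trans lt_b (leq_trans le_v _).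
  rewrite append_val_lift append_val_max ltn_bump_self.
  by case: eqP => // -> /=; rewrite leqNgt ltn_ord.
case: ifPn => [_ | v_lt].
  apply/inv_bound_leq => a b ab sab; rewrite -(small a b) //.
  rewrite -append_val_lift; apply: (@ltn_inv_bound _ _ (lift ord_max a)).
    by rewrite !lift_max.
  by rewrite !append_val_lift ltn_bump2.
have vn : v < n by have := ltn_ord v; move: v_lt; rewrite -val_eqE /=; lia.
(* The entry of [s] equal to [v] is raised to [v.+1], and so it exceeds the appended [v]. *)
pose a := ((s^-1)%g (Ordinal vn)).
have := @ltn_inv_bound _ (append_val s v) (lift ord_max a) ord_max.
by rewrite append_val_max append_val_lift permKV ltn_bump_self; apply.
Qed.

(** * Weighted sums over 321-avoiding permutations and their recursion *)

Section Weight.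
Variable R : comNzRingType.
Variable x : nat -> R.
Local Open Scope ring_scope.

Definition perm_wt n (s : 'S_n) : R := \prod_(j in perm_Des s) x j.

Lemma mem_perm_Des_append n (s : 'S_n) v (j : 'I_n) :
  (lift ord_max j \in perm_Des (append_val s v)) = (j \in perm_Des s).
Proof.
rewrite !inE; apply/existsP/existsP => -[a /andP[aj saj]].
  case: (unliftP ord_max a) aj saj => [{}a ->|->]; rewrite !lift_max.
    rewrite !append_val_lift ltn_bump2 => aj saj.
    by exists a; rewrite aj.
  by move=> /eqP /= E; have := ltn_ord j; rewrite -E => /ltnW; rewrite ltnn.
by exists (lift ord_max a); rewrite !lift_max !append_val_lift ltn_bump2 aj.
Qed.

Lemma perm_wt_append n (s : 'S_n) v :
  perm_wt (append_val s v) =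
  perm_wt s * (if [exists a : 'I_n, (a.+1 == n) && (v <= s a)%N] then x n else 1).
Proof.
rewrite /perm_wt big_mkcond big_ord_recr /=; congr (_ * _); last first.
  rewrite inE append_val_max; congr (if _ then _ else _).
  apply/existsP/existsP => -[a /andP[aj saj]].
    case: (unliftP ord_max a) aj saj => [{}a ->|->]; last by rewrite /= eqn_leq ltnn.
    rewrite lift_max append_val_lift ltn_bump_self => aj saj.
    by exists a; rewrite aj.
  by exists (lift ord_max a); rewrite lift_max append_val_lift ltn_bump_self aj.
rewrite [RHS]big_mkcond; apply: eq_bigr => j _.
have -> : widen_ord (leqnSn n) j = lift ord_max j.
  by apply: ord_inj; rewrite lift_max.
by rewrite mem_perm_Des_append.
Qed.

Definition last_is_max n (s : 'S_n) : bool :=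
  [exists a : 'I_n, (a.+1 == n) && ((s a).+1 == n)].

(* A last entry that is not maximal is exceeded by some earlier entry. *)
Lemma append_descent n (s : 'S_n) (v : 'I_n.+1) : (inv_bound s <= v)%N ->
  [exists a : 'I_n, (a.+1 == n) && (v <= s a)%N] =
  last_is_max s && (v != ord_max).
Proof.
move=> le_v; rewrite /last_is_max.
apply/existsP/andP => [[a /andP[/eqP an vsa]] | [/existsP[a /andP[an /eqP san]] vn]];
  last first.
  exists a; rewrite an; have := ltn_ord v; move: vn; rewrite -val_eqE /=; lia.
have sa := ltn_ord (s a).
split; last by rewrite -val_eqE /=; lia.
apply/existsP; exists a; rewrite an eqxx /=; apply/negP => sa_max.
have nn : (n.-1 < n)%N by lia.
(* The position of the maximal value: it precedes [a], which makes [s a] an inversion bottom and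
   forces [s a < inv_bound s <= v], against [v <= s a]. *)
pose b := ((s^-1)%g (Ordinal nn)).
have sb : s b = n.-1 :> nat by rewrite permKV.
have nab : b != a by apply/eqP => E; move: sa_max; rewrite -E sb; lia.
have ba : (b < a)%N.
  have := ltn_ord b; move: nab; rewrite -val_eqE /= => /eqP; lia.
have sab : (s a < s b)%N by rewrite sb; lia.
have := ltn_inv_bound ba sab; lia.
Qed.

(* The argument of [phi] is the number [h] of admissible non-maximal last values. *)
Definition perm_sum n (phi : nat -> R) : R :=
  \sum_(s in S321 n) perm_wt s * phi (n - inv_bound s)%N.

(** The functional [phi] evaluated on [E e_h]; evaluation on [U e_h] is simply [phi h.+1]. *)
Definition tail_sum (phi : nat -> R) (h : nat) : R := \sum_(j < h) phi j.+1.

Lemma sum_append_val n (F : 'S_n.+1 -> R) :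
  \sum_(s in S321 n.+1) F s =
  \sum_(s in S321 n) \sum_(v : 'I_n.+1 | (inv_bound s <= v)%N) F (append_val s v).
Proof.
rewrite (reindex _ (onW_bij _ (append_val_bij n))) /=.
rewrite pair_big_dep /=; apply: eq_bigl => -[s v] /=.
by rewrite append_val_S321.
Qed.

Lemma sum_append_last n m (F : 'I_n.+1 -> R) : (m <= n)%N ->
  \sum_(v : 'I_n.+1 | (m <= v)%N) F v =
  \sum_(v : 'I_n | (m <= v)%N) F (lift ord_max v) + F ord_max.
Proof.
move=> mn; rewrite big_mkcond big_ord_recr /= mn; congr (_ + _).
rewrite [RHS]big_mkcond; apply: eq_bigr => v _.
have -> // : widen_ord (leqnSn n) v = lift ord_max v.
by apply: ord_inj; rewrite lift_max.
Qed.

(** Appending a non-maximal [v] gives size [n.+1] and bound [v.+1], hence the new parameter [n - v];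
    it runs from 1 to the old parameter [n - m]. *)
Lemma tail_sum_rev n m (phi : nat -> R) :
  \sum_(v : 'I_n | (m <= v)%N) phi (n - v)%N = tail_sum phi (n - m).
Proof.
rewrite /tail_sum (big_ord_widen n (fun j => phi j.+1)) ?leq_subr //.
rewrite (reindex_inj rev_ord_inj) /=; apply: eq_big => [v | v _].
  by have := ltn_ord v; lia.
by congr phi; have := ltn_ord v; lia.
Qed.

(** The maximal value never creates a descent; the others create one exactly when the old last entry
    is maximal. Counting them first with factor 1 leaves the correction [x n - 1]. *)
Lemma perm_sum_step n (phi : nat -> R) :
  perm_sum n.+1 phi =
  perm_sum n (fun h => phi h.+1 + tail_sum phi h)
  + (x n - 1) * \sum_(s in S321 n | last_is_max s)
                   perm_wt s * tail_sum phi (n - inv_bound s).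
Proof.
rewrite /perm_sum sum_append_val big_mkcondr mulr_sumr -big_split /=.
apply: eq_bigr => s _; have mn := inv_bound_le s.
rewrite sum_append_last // perm_wt_append append_descent // eqxx andbF mulr1.
rewrite inv_bound_append // eqxx subSn //.
rewrite -tail_sum_rev.
under eq_bigr => v Hv do
  rewrite perm_wt_append append_descent ?inv_bound_append ?lift_max //
    eq_sym neq_lift andbT (negbTE (neq_lift _ _)) subSS mulrAC.
rewrite -mulr_suml -mulr_sumr; case: last_is_max; ring.
Qed.

Lemma perm_sum_last_is_max n (phi : nat -> R) :
  \sum_(s in S321 n.+1 | last_is_max s) perm_wt s * phi (n.+1 - inv_bound s)%N =
  perm_sum n (fun h => phi h.+1).
Proof.
rewrite big_mkcondr sum_append_val; apply: eq_bigr => s _.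
have mn := inv_bound_le s.
have lastE v : last_is_max (append_val s v) = (v == ord_max).
  apply/existsP/eqP => [[a /andP[/eqP an /eqP san]] | ->].
    have E : a = ord_max by apply: val_inj => /=; lia.
    by apply: val_inj; move: san; rewrite E append_val_max /=; lia.
  by exists ord_max; rewrite append_val_max /= eqxx.
rewrite sum_append_last // big1 ?add0r => [|v _].
  rewrite lastE eqxx perm_wt_append append_descent // eqxx andbF mulr1.
  by rewrite inv_bound_append // eqxx subSn.
by rewrite lastE eq_sym (negbTE (neq_lift _ _)).
Qed.

Lemma perm_sumSS n (phi : nat -> R) :
  perm_sum n.+2 phi =
  perm_sum n.+1 (fun h => phi h.+1 + tail_sum phi h)
  + (x n.+1 - 1) * perm_sum n (fun h => tail_sum phi h.+1).
Proof.
by rewrite perm_sum_step (perm_sum_last_is_max _ (tail_sum phi)).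
Qed.

Lemma perm_sum0 (phi : nat -> R) : perm_sum 0 phi = phi 0.
Proof.
have P (s : 'S_0) : s = 1%g by apply/permP => -[].
rewrite /perm_sum (big_pred1 1%g) => [|s].
  by rewrite /perm_wt big1 ?mul1r ?sub0n // => -[].
rewrite (P s) /= eqxx; apply/S321P => -[]//.
Qed.

Lemma perm_sum1 (phi : nat -> R) : perm_sum 1 phi = phi 1.
Proof.
rewrite perm_sum_step perm_sum0 /tail_sum big_ord0 addr0 big1 ?mulr0 ?addr0 //.
by move=> s /andP[_ /existsP[[]]].
Qed.

End Weight.

(** * Ballot words *)

(* A letter [true] at position [j] means that the entry [j] (counted from 0)
   lies in row 2 of the tableau. *)
Definition ballot (w : seq bool) : bool :=
  [forall j : 'I_(size w).+1, (count id (take j w)).*2 <= j].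

Lemma ballot_rcons w b :
  ballot (rcons w b) = ballot w && ((count id w + b).*2 <= (size w).+1).
Proof.
rewrite /ballot size_rcons; apply/forallP/andP => [H | [/forallP H Hb] j].
  split.
    apply/forallP => j; have := H (widen_ord (leqnSn _) j).
    by rewrite /= -cats1 takel_cat // -ltnS.
  have := H ord_max; rewrite /= -(size_rcons w b) take_size -cats1.
  by rewrite count_cat /= addn0.
have := ltn_ord j; rewrite ltnS leq_eqVlt => /predU1P[-> | lt_j].
  by rewrite -(size_rcons w b) take_size size_rcons -cats1 count_cat /= addn0.
by have := H (Ordinal lt_j); rewrite -cats1 takel_cat.
Qed.

Section Weight.
Variable R : comNzRingType.
Variable x : nat -> R.
Local Open Scope ring_scope.

(** The tableau entries [j] and [j+1], numbered from 1, sit at the positions [j.-1] and [j] of the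
    word; a descent goes from row 1 to row 2. *)
Definition word_Des (w : seq bool) (j : nat) : bool :=
  [&& (0 < j)%N, ~~ nth false w j.-1 & nth false w j].

Definition word_wt (w : seq bool) : R := \prod_(j < size w | word_Des w j) x j.

Lemma word_wt_rcons w b :
  word_wt (rcons w b) =
  word_wt w * (if [&& (0 < size w)%N, ~~ last true w & b] then x (size w) else 1).
Proof.
rewrite /word_wt size_rcons big_mkcond big_ord_recr /= -big_mkcond /=.
congr (_ * _).
  apply: eq_bigl => j; rewrite /word_Des !nth_rcons ltn_ord.
  by rewrite (leq_ltn_trans (leq_pred j) (ltn_ord j)).
rewrite /word_Des !nth_rcons ltnn eqxx; case: (posnP (size w)) => //= w_gt0.
by rewrite prednK // leqnn nth_last; case: (w) w_gt0.
Qed.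

(** Here [psi] takes the length [k] of the second row; the difference of the row lengths is
    [n - k.*2]. *)
Definition word_sum n (psi : nat -> R) : R :=
  \sum_(w : n.-tuple bool | ballot w) word_wt w * psi (count id w).

Lemma rcons_tuple_bij (T : finType) n :
  bijective (fun wb : n.-tuple T * T => [tuple of rcons wb.1 wb.2]).
Proof.
apply: inj_card_bij => [[w b] [w' b'] /= E|].
  have [/val_inj-> ->] // := rcons_inj (congr1 val E).
by rewrite card_prod !card_tuple expnSr.
Qed.

Lemma ballot_count n (w : n.-tuple bool) : ballot w -> ((count id w).*2 <= n)%N.
Proof.
move/forallP/(_ ord_max); by rewrite /= take_size size_tuple.
Qed.

(** Extending the first row is always allowed; extending the second is subject to the ballot
    condition on the whole word. *)
Lemma sum_rcons n (F : seq bool -> R) :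
  \sum_(w : n.+1.-tuple bool | ballot w) F w =
  \sum_(w : n.-tuple bool | ballot w)
     (F (rcons w false)
      + if ((count id w).+1.*2 <= n.+1)%N then F (rcons w true) else 0).
Proof.
rewrite (reindex _ (onW_bij _ (rcons_tuple_bij _ n))) /=.
under eq_bigl do rewrite ballot_rcons size_tuple.
rewrite -(pair_big_dep (fun w : n.-tuple bool => ballot w)
  (fun (w : n.-tuple bool) (b : bool) => (count id w + b).*2 <= n.+1)%N
  (fun w b => F (rcons w b))) /=; apply: eq_bigr => w Hw.
rewrite big_mkcond /= big_bool /= addn0 addn1 addrC; congr (_ + _).
by rewrite -ltnS (leq_ltn_trans (ballot_count Hw)).
Qed.

Lemma word_sum_step n (psi : nat -> R) :
  word_sum n.+1 psi =
  word_sum n (fun k => psi k + if (k.+1.*2 <= n.+1)%N then psi k.+1 else 0)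
  + (x n - 1) *
    \sum_(w : n.-tuple bool | ballot w && ((0 < n)%N && ~~ last true w))
       word_wt w * (if ((count id w).+1.*2 <= n.+1)%N then psi (count id w).+1 else 0).
Proof.
rewrite /word_sum (sum_rcons n (fun w => word_wt w * psi (count id w))).
rewrite big_mkcondr mulr_sumr -big_split /=.
apply: eq_bigr => w _; rewrite !word_wt_rcons !andbF andbT size_tuple.
rewrite -!cats1 !count_cat /= !addn0 addn1.
case: ifP => _; case: ifP => _; ring.
Qed.

(** This is [D U = 1]: after a letter [false] the letter [true] is always allowed, and the pair
    restores the difference of the row lengths. *)
Lemma word_sum_last n (psi : nat -> R) :
  \sum_(w : n.+1.-tuple bool | ballot w && ((0 < n.+1)%N && ~~ last true w))
       word_wt w * (if ((count id w).+1.*2 <= n.+2)%N then psi (count id w).+1 else 0)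
  = word_sum n (fun k => psi k.+1).
Proof.
rewrite big_mkcondr /= (sum_rcons n (fun w => if ~~ last true w then word_wt w *
  (if ((count id w).+1.*2 <= n.+2)%N then psi (count id w).+1 else 0) else 0)).
apply: eq_bigr => w Hw; rewrite !last_rcons /= if_same addr0.
rewrite word_wt_rcons !andbF mulr1 -cats1 count_cat /= !addn0 doubleS ltnS.
by rewrite ltnS ballot_count.
Qed.

Lemma word_sumSS n (psi : nat -> R) :
  word_sum n.+2 psi =
  word_sum n.+1 (fun k => psi k + if (k.*2 <= n)%N then psi k.+1 else 0)
  + (x n.+1 - 1) * word_sum n (fun k => psi k.+1).
Proof. by rewrite word_sum_step word_sum_last. Qed.

Lemma word_sum0 (psi : nat -> R) : word_sum 0 psi = psi 0%N.
Proof.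
rewrite /word_sum (big_pred1 [tuple]) => [|w].
  by rewrite /word_wt big_ord0 mul1r.
by rewrite [w]tuple0 /= eqxx; apply/forallP => -[[]].
Qed.

Lemma word_sum1 (psi : nat -> R) : word_sum 1 psi = psi 0%N.
Proof.
rewrite word_sum_step word_sum0 addr0 big1 ?mulr0 ?addr0 // => w.
by rewrite andbF.
Qed.

(** The action of [S = E U] on functionals. *)
Definition tail_sumS (phi : nat -> R) (h : nat) : R := tail_sum phi h.+1.

Lemma tail_sumSr (phi : nat -> R) h : tail_sum phi h.+1 = tail_sum phi h + phi h.+1.
Proof. exact: big_ord_recr. Qed.

Lemma tail_sum_ext (phi psi : nat -> R) : phi =1 psi -> tail_sum phi =1 tail_sum psi.
Proof. by move=> E h; apply: eq_bigr. Qed.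

(** The commutation of [S] with [U + E], in transposed form. Both sides grow by [tail_sum phi h.+3]
    when [h] is replaced by [h.+1]. *)
Lemma tail_sumS_comm (phi : nat -> R) h :
  tail_sumS (fun h => phi h.+1 + tail_sum phi h) h =
  tail_sumS phi h.+1 + tail_sum (tail_sumS phi) h.
Proof.
rewrite /tail_sumS; elim: h => [|h IH].
  rewrite /tail_sum !big_ord_recr !big_ord0 /= ?big_ord0; ring.
rewrite tail_sumSr IH (tail_sumSr (fun h => _) h) !(tail_sumSr phi h.+2); ring.
Qed.

Lemma iter_tail_sumS_comm k (phi : nat -> R) h :
  iter k tail_sumS (fun h => phi h.+1 + tail_sum phi h) h =
  iter k tail_sumS phi h.+1 + tail_sum (iter k tail_sumS phi) h.
Proof.
elim: k h => [//|k IH] h.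
by rewrite /= -tail_sumS_comm; apply: tail_sum_ext.
Qed.

(** Both sides obey the same two-step recursion: commutation moves [U + E] past [S^k], where [E]
    becomes the letter [true], which turns [S^k] into [S^(k+1)] and lowers the difference by one. *)
Lemma perm_sum_word_sum n (phi : nat -> R) :
  perm_sum x n phi = word_sum n (fun k => iter k tail_sumS phi (n - k.*2)%N).
Proof.
elim/ltn_ind: n phi => -[|[|n]] IH phi.
- by rewrite perm_sum0 word_sum0.
- by rewrite perm_sum1 word_sum1.
rewrite perm_sumSS word_sumSS !IH //; congr (_ + _ * _).
  apply: eq_bigr => w Hw; congr (_ * _); have := ballot_count Hw.
  set k := count id w => le_k; rewrite iter_tail_sumS_comm -subSn //.
  congr (_ + _); case: ifP => k_le; last first.
    (* With rows of equal length no [true] may follow; correspondingly [E e_0 = 0]. *)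
    by have -> : (n.+1 - k.*2 = 0)%N; [lia | rewrite /tail_sum big_ord0].
  by rewrite /= /tail_sumS doubleS !subSS subSn.
by apply: eq_bigr => w _; rewrite doubleS !subSS -iterSr.
Qed.

End Weight.

(** * Two-row standard tableaux as ballot words *)

(** The elements below [j] form an initial segment of a sorted list. *)
Lemma sorted_nth_ltn (s : seq nat) i j : sorted ltn s -> i < size s ->
  (nth 0 s i < j) = (i < count (fun y => y < j) s).
Proof.
elim: s i => //= y s IH i path_s.
have sorted_s := path_sorted path_s.
case: (ltnP y j) => [yj | jy] lt_i.
  by case: i lt_i => //= i lt_i; rewrite add1n ltnS IH.
have ge_s : all (fun z => j <= z) (y :: s).
  rewrite /= jy; apply: sub_all (order_path_min ltn_trans path_s) => z /= yz.
  exact: leq_trans jy (ltnW yz).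
have -> : count (fun z => z < j) s = 0.
  apply/eqP; rewrite -leqn0 leqNgt -has_count; apply/hasPn => z zs.
  by rewrite -leqNgt; have /andP[_ /allP->] := ge_s.
have := @mem_nth _ 0 (y :: s) i lt_i => /(allP ge_s).
by rewrite addn0 ltnNge => ->.
Qed.

(** A row of the tableau, read from left to right: the second row for [b = true], the first for
    [b = false]. *)
Definition positions (w : seq bool) (b : bool) : seq nat :=
  [seq j <- iota 0 (size w) | nth false w j == b].

Lemma sorted_positions w b : sorted ltn (positions w b).
Proof. exact/sorted_filter/iota_ltn_sorted/ltn_trans. Qed.

Lemma mem_positions w b j :
  (j \in positions w b) = (nth false w j == b) && (j < size w).
Proof. by rewrite mem_filter mem_iota add0n. Qed.

Lemma count_positions w b j : j <= size w ->
  count (fun y => y < j) (positions w b) = count (pred1 b) (take j w).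
Proof.
move=> le_j; rewrite count_filter -(map_nth_iota0 false le_j) count_map.
rewrite -(subnKC le_j) iotaD count_cat add0n.
rewrite (@eq_in_count _ _ pred0 (iota j _)) ?count_pred0 ?addn0.
  by apply: eq_in_count => y; rewrite mem_iota add0n /= => ->.
by move=> y; rewrite mem_iota /= => /andP[jy _]; rewrite ltnNge jy.
Qed.

Lemma size_positions w b : size (positions w b) = count (pred1 b) w.
Proof.
rewrite -[in RHS](take_size w) -count_positions // -[LHS]count_predT.
by apply: eq_in_count => y; rewrite mem_positions => /andP[_ ->].
Qed.

Lemma count_pred1_bool (w : seq bool) :
  (count (pred1 true) w = count id w) * (count (pred1 false) w = size w - count id w).
Proof.
have E : count (pred1 true) w = count id w by apply: eq_count => -[].
split => //; rewrite -E -(count_predC (pred1 true) w) addKn.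
by apply: eq_count => -[].
Qed.

(** The ballot condition is the increase down columns. The bound on [count id w] makes the first row
    long enough for no [nth] to fall back on its default. *)
Lemma ballot_positionsP w : (count id w).*2 <= size w ->
  reflect (forall i, i < count id w ->
             nth 0 (positions w false) i < nth 0 (positions w true) i)
          (ballot w).
Proof.
move=> le_w; apply: (iffP forallP) => [H i lt_i | H j].
  have lt_i1 : i < size (positions w true) by rewrite size_positions count_pred1_bool.
  have lt_i0 : i < size (positions w false).
    by rewrite size_positions count_pred1_bool; lia.
  have := mem_nth 0 lt_i1; have := mem_nth 0 lt_i0; rewrite !mem_positions.
  set y0 := nth 0 _ _; set y1 := nth 0 _ _ => /andP[/eqP w0 _] /andP[/eqP w1 lt_y1].
  have y01 : y0 != y1 by apply/eqP => E; rewrite E w1 in w0.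
  (* The prefix cut just after [y1] contains [i.+1] letters [true], hence by the ballot condition at
     least as many [false]. *)
  have : y1 < y1.+1 by [].
  rewrite {1}/y1 sorted_nth_ltn ?sorted_positions // count_positions //.
  have := H (Ordinal (lt_y1 : y1.+1 < (size w).+1)) => /=.
  have : y0 < y1.+1 = (i < count (pred1 false) (take y1.+1 w)).
    by rewrite /y0 sorted_nth_ltn ?sorted_positions // count_positions.
  rewrite !count_pred1_bool size_take_min (minn_idPl lt_y1); lia.
have le_j : j <= size w by rewrite -ltnS.
rewrite leqNgt; apply/negP => lt_j.
(* The number of [false] in a violating prefix: the [true] of index [i] lies in it, so the [false]
   of index [i] would too, one more than there are. *)
set i := j - count id (take j w).
have i_lt : i < count (pred1 true) (take j w) by rewrite count_pred1_bool /i; lia.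
have i_lt_w : i < count id w.
  rewrite -(cat_take_drop j w) count_cat; move: i_lt; rewrite count_pred1_bool; lia.
have lt_i1 : i < size (positions w true) by rewrite size_positions count_pred1_bool.
have lt_i0 : i < size (positions w false).
  by rewrite size_positions count_pred1_bool; lia.
move: i_lt; rewrite -count_positions // -sorted_nth_ltn ?sorted_positions //.
move/(ltn_trans (H i i_lt_w)).
rewrite sorted_nth_ltn ?sorted_positions // count_positions // count_pred1_bool.
by rewrite size_take_min (minn_idPl le_j) ltnn.
Qed.

Lemma cell_rowcol_inj la (c d : cell la) :
  cell_row c = cell_row d -> cell_col c = cell_col d -> c = d.
Proof.
case: c d => [r i] [r' i']; rewrite /cell_row /cell_col /= => /ord_inj E.
by case: _ / E i' => i' /ord_inj->.
Qed.

Lemma cell_exists la r j : j < nth 0 la r ->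
  exists2 c : cell la, cell_row c = r & cell_col c = j.
Proof.
move=> lt_j; have lt_r : r < size la.
  by rewrite ltnNge; apply: contraL lt_j => /(nth_default 0)->.
by exists (existT _ (Ordinal lt_r) (Ordinal lt_j)).
Qed.

Lemma cell_col_lt la (c : cell la) : cell_col c < nth 0 la (cell_row c).
Proof. exact: ltn_ord. Qed.

Section TwoRows.
Variables (n' k : nat).
Let n := n'.+1.
Hypothesis le_kn : k.*2 <= n.
Let la := [:: n - k; k].

(** Row numbers are 0 and 1, so they can be exchanged with the letters of a word. *)
Lemma cell_row2 (c : cell la) : cell_row c = (cell_row c == 1).
Proof. by rewrite /cell_row; case: (tag c) => -[|[|m]]. Qed.

Lemma size_positions_shape w (b : bool) :
  size w = n -> count id w = k -> size (positions w b) = nth 0 la b.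
Proof. by move=> sw cw; rewrite size_positions; case: b; rewrite count_pred1_bool ?sw cw. Qed.

Definition tab_word (T : filling n la) : n.-tuple bool :=
  [tuple [exists c : cell la, (cell_row c == 1) && (T c == x)] | x < n].

Definition word_tab (w : seq bool) : filling n la :=
  [ffun c => inord (nth 0 (positions w (cell_row c == 1)) (cell_col c))].

Lemma nth_tab_word (T : filling n la) c :
  injective T -> nth false (tab_word T) (T c) = (cell_row c == 1).
Proof.
move=> injT; rewrite -tnth_nth tnth_mktuple.
apply/existsP/idP => [[d /andP[row_d /eqP/injT <-]] // | row_c].
by exists c; rewrite row_c /=.
Qed.

Lemma SYTP (T : filling n la) :
  reflect
    [/\ injective T, forall j, exists c, T c = j,
        forall c d, cell_row c = cell_row d -> cell_col c < cell_col d -> T c < T d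
      & forall c d, cell_col c = cell_col d -> cell_row c < cell_row d -> T c < T d]
    (T \in SYT n la).
Proof.
rewrite inE; apply: (iffP and4P) => [[/injectiveP H1 /forallP H2 /forallP H3 /forallP H4]
  | [H1 H2 H3 H4]]; split=> //.
- by move=> j; have /existsP[c /eqP] := H2 j; exists c.
- by move=> c d cd lt_cd; have /forallP/(_ d) := H3 c; rewrite cd eqxx lt_cd.
- by move=> c d cd lt_cd; have /forallP/(_ d) := H4 c; rewrite cd eqxx lt_cd.
- exact/injectiveP.
- by apply/forallP => j; apply/existsP; have [c <-] := H2 j; exists c.
- apply/forallP => c; apply/forallP => d; apply/implyP => /andP[/eqP]; exact: H3.
- apply/forallP => c; apply/forallP => d; apply/implyP => /andP[/eqP]; exact: H4.
Qed.

(** Two strictly increasing lists with the same elements are equal. *)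
Lemma SYT_row (T : filling n la) (r : 'I_2) : T \in SYT n la ->
  [seq val (T (existT (fun r : 'I_2 => 'I_(nth 0 la r)) r j)) | j <- enum 'I_(nth 0 la r)]
  = positions (tab_word T) (val r == 1).
Proof.
case/SYTP => injT surjT rowT _.
apply: (irr_sorted_eq ltn_trans ltnn); last 1 first.
- move=> y; rewrite mem_positions size_tuple; apply/mapP/andP => [[j _ ->] | [wy lt_y]].
    by rewrite nth_tab_word // eqxx ltn_ord.
  have [d Td] := surjT (Ordinal lt_y).
  have Ey : y = T d by rewrite Td.
  move: wy; rewrite Ey nth_tab_word // => /eqP Er.
  have Erow : cell_row d = r.
    by rewrite cell_row2 Er; case: (r) => -[|[|m]].
  have {Erow Er Td} : tag d = r by apply: ord_inj.
  by case: d Ey => r' j Ey /= <-; exists j; rewrite ?mem_enum.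
- rewrite sorted_map.
  have : sorted ltn [seq val j | j <- enum 'I_(nth 0 la r)].
    by rewrite val_enum_ord iota_ltn_sorted.
  rewrite sorted_map; apply: sub_sorted => i j /= lt_ij; exact: rowT.
- exact: sorted_positions.
Qed.

Lemma SYT_val (T : filling n la) c : T \in SYT n la ->
  T c = nth 0 (positions (tab_word T) (cell_row c == 1)) (cell_col c) :> nat.
Proof.
move=> /SYT_row rowT; case: c => r j; rewrite /cell_row /cell_col /= -rowT.
by rewrite (nth_map j) ?size_enum_ord // nth_ord_enum.
Qed.

Lemma tab_wordK T : T \in SYT n la -> word_tab (tab_word T) = T.
Proof.
by move=> HT; apply/ffunP => c; rewrite ffunE -SYT_val // inord_val.
Qed.

Lemma count_tab_word T : T \in SYT n la -> count id (tab_word T) = k.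
Proof.
move=> /(SYT_row (Ordinal (isT : 1 < 2)))/(congr1 size).
by rewrite size_positions count_pred1_bool size_map size_enum_ord.
Qed.

Lemma ballot_tab_word T : T \in SYT n la -> ballot (tab_word T).
Proof.
move=> HT; have cw := count_tab_word HT; have [_ _ _ colT] := SYTP _ HT.
apply/ballot_positionsP; rewrite cw ?size_tuple // => i lt_ik.
have [c row_c col_c] := @cell_exists la 1 i lt_ik.
have [|d row_d col_d] := @cell_exists la 0 i; first by rewrite /=; lia.
have := colT d c; rewrite !SYT_val // row_c row_d col_c col_d; exact.
Qed.

Section WordTab.
Variable w : n.-tuple bool.
Hypotheses (ballot_w : ballot w) (count_w : count id w = k).

Let col_lt (c : cell la) : cell_col c < size (positions w (cell_row c == 1)).
Proof.
by rewrite size_positions_shape ?size_tuple // -cell_row2 cell_col_lt.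
Qed.

Lemma mem_word_tab (c : cell la) :
  nth 0 (positions w (cell_row c == 1)) (cell_col c)
    \in positions w (cell_row c == 1).
Proof. exact: mem_nth. Qed.

Lemma word_tab_val (c : cell la) :
  word_tab w c = nth 0 (positions w (cell_row c == 1)) (cell_col c) :> nat.
Proof.
rewrite ffunE inordK //; have := mem_word_tab c.
by rewrite mem_positions size_tuple => /andP[].
Qed.

Lemma nth_word_tab (c : cell la) : nth false w (word_tab w c) = (cell_row c == 1).
Proof.
by have := mem_word_tab c; rewrite word_tab_val mem_positions => /andP[/eqP].
Qed.

(** Rows increase because [positions] is sorted, columns by the ballot condition; an entry [j] is
    found in the row given by its letter, at its index in [positions]. *)
Lemma word_tab_SYT : word_tab w \in SYT n la.
Proof.
have injw : injective (word_tab w).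
  move=> c d E.
  have Erow : (cell_row c == 1) = (cell_row d == 1) by rewrite -!nth_word_tab E.
  apply: cell_rowcol_inj; first by rewrite cell_row2 Erow -cell_row2.
  apply/eqP; rewrite -(nth_uniq 0 (col_lt c)).
  - by rewrite -word_tab_val E word_tab_val Erow.
  - by rewrite Erow.
  - exact: sorted_uniq ltn_trans ltnn _ (sorted_positions _ _).
have le_w : (count id w).*2 <= size w by rewrite size_tuple count_w.
apply/SYTP; split=> // [j | c d Erow lt_cd | c d Ecol lt_cd].
- have : val j \in positions w (nth false w j).
    by rewrite mem_positions eqxx size_tuple ltn_ord.
  set b := nth _ _ _ => j_in.
  have [|c row_c col_c] := @cell_exists la b (index (val j) (positions w b)).
    by rewrite -(@size_positions_shape w) ?size_tuple // index_mem.
  exists c; apply: val_inj; rewrite /= word_tab_val row_c col_c.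
  by rewrite eqb1 nth_index.
- rewrite !word_tab_val -Erow.
  apply: (sorted_ltn_nth ltn_trans) => //; first exact: sorted_positions.
    exact: col_lt.
  by rewrite inE Erow col_lt.
- have [row_c row_d] : cell_row c = 0 /\ cell_row d = 1.
    by have := cell_row2 c; have := cell_row2 d; lia.
  have := col_lt d; rewrite !word_tab_val size_positions row_c row_d Ecol.
  by rewrite count_pred1_bool; apply: (ballot_positionsP le_w).
Qed.

Lemma word_tabK : tab_word (word_tab w) = w.
Proof.
have [injT surjT _ _] := SYTP _ word_tab_SYT.
apply: eq_from_tnth => x; rewrite !(tnth_nth false).
by have [c <-] := surjT x; rewrite nth_tab_word // nth_word_tab.
Qed.

End WordTab.

Section Weight.
Variables (R : comNzRingType) (x : nat -> R).
Local Open Scope ring_scope.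

Lemma mem_tab_Des T j : T \in SYT n la -> (j \in tab_Des T) = word_Des (tab_word T) j.
Proof.
case/SYTP => injT surjT _ _; rewrite inE /word_Des.
apply/existsP/and3P => [[c /existsP[d /and3P[/eqP Tc /eqP Td cd]]] | [j_gt0 wj1 wj]].
  rewrite -Tc /= nth_tab_word // Tc -Td nth_tab_word //.
  by have := cell_row2 c; have := cell_row2 d; split; rewrite ?Td -?Tc //; lia.
have lt_j1 : (j.-1 < n)%N := leq_ltn_trans (leq_pred j) (ltn_ord j).
have [c Tc] := surjT (Ordinal lt_j1); have [d Td] := surjT j.
have Ej : j.-1 = T c by rewrite Tc.
exists c; apply/existsP; exists d; rewrite Td eqxx -Ej prednK // eqxx /=.
move: wj1 wj; rewrite Ej -Td !nth_tab_word //.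
by have := cell_row2 c; have := cell_row2 d; lia.
Qed.

Lemma sum_SYT :
  \sum_(T in SYT n la) \prod_(j in tab_Des T) x j =
  \sum_(w : n.-tuple bool | ballot w && (count id w == k)) word_wt x w.
Proof.
rewrite (reindex_onto (fun w : n.-tuple bool => word_tab w) tab_word) /=; last first.
  exact: tab_wordK.
apply: eq_big => w.
  apply/andP/andP => [[HT /eqP <-] | [ballot_w /eqP count_w]].
    by rewrite ballot_tab_word // count_tab_word.
  by rewrite word_tab_SYT // word_tabK.
case/andP => HT /eqP Ew; rewrite -[in RHS]Ew /word_wt size_tuple.
by apply: eq_bigl => j; rewrite mem_tab_Des.
Qed.

End Weight.
End TwoRows.

(** * Ballot numbers and extraction of coefficients *)

Local Open Scope ring_scope.

(** Distinct descents have distinct successors, all lying in the second row. This is why the final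
    sum may start at [k = i]. *)
Lemma leq_tab_des n' k (T : filling n'.+1 [:: (n'.+1 - k)%N; k]) :
  (k.*2 <= n'.+1)%N -> T \in SYT n'.+1 [:: (n'.+1 - k)%N; k] -> (tab_des T <= k)%N.
Proof.
move=> le_k HT; rewrite -[leqRHS](count_tab_word HT) -(count_pred1_bool _).1.
rewrite -size_positions /tab_des cardE -(size_map val); apply: uniq_leq_size.
  by rewrite map_inj_uniq ?enum_uniq //; apply: val_inj.
move=> _ /mapP[j + ->]; rewrite mem_enum mem_tab_Des // => /and3P[_ _ wj].
by rewrite mem_positions wj size_tuple /=.
Qed.

Lemma perm_wt_sum_SYT (R : comNzRingType) (x : nat -> R) (n' : nat) (n := n'.+1) :
  \sum_(s in S321 n) perm_wt x s =
  \sum_(k < (n./2).+1) iter k (@tail_sumS R) (fun=> 1) (n - k.*2)%N *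
     \sum_(T in SYT n [:: (n - k)%N; nat_of_ord k]) \prod_(j in tab_Des T) x j.
Proof.
transitivity (perm_sum x n (fun=> 1)).
  by apply: eq_bigr => s _; rewrite mulr1.
have half (w : n.-tuple bool) : ballot w -> (count id w < (n./2).+1)%N.
  by move/ballot_count; lia.
rewrite perm_sum_word_sum /word_sum.
pose p (w : n.-tuple bool) : 'I_(n./2).+1 := inord (count id w).
rewrite (partition_big p xpredT) //= /p.
apply: eq_bigr => k _; have lek : (k.*2 <= n)%N by have := ltn_ord k; lia.
rewrite sum_SYT // mulr_sumr; apply: eq_big => w.
  case bw : (ballot w) => //=; have := half w bw => lt_w.
  by rewrite -val_eqE /= inordK.
by case/andP=> bw /eqP <-; rewrite inordK ?half // mulrC.
Qed.

(** Ballot numbers, by Pascal's rule in a double induction. Taking [k.+1] avoids the truncated index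
    [k - 1] at [k = 0]. *)
Lemma iter_tail_sumS1 (R : comNzRingType) k h :
  iter k.+1 (@tail_sumS R) (fun=> 1) h =
  'C(h + k.+1.*2, k.+1)%:R - 'C(h + k.+1.*2, k)%:R.
Proof.
elim: k h => [|k IHk] h.
  rewrite /= /tail_sumS /tail_sum sumr_const card_ord bin1 bin0 -natrB; last lia.
  by congr (_%:R); lia.
elim: h => [|h IHh].
  rewrite iterS /tail_sumS /tail_sum big_ord1 IHk add0n add1n.
  have -> : k.+2.*2 = k.+1.*2.+2 by lia.
  (* The symmetry of the two central binomials of an odd row supplies the boundary case [h = 0]. *)
  have E : 'C(k.+1.*2.+1, k.+2) = 'C(k.+1.*2.+1, k.+1).
    by rewrite -[RHS]bin_sub; [congr 'C(_, _) |]; lia.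
  by rewrite [in RHS]binS [in X in _ = _ - X]binS E !natrD; ring.
rewrite iterS [LHS]tail_sumSr -/(tail_sumS _ h) -iterS IHh IHk.
have -> : (h.+2 + k.+1.*2 = h + k.+2.*2)%N by lia.
by rewrite addSn [in RHS]binS [in X in _ = _ - X]binS !natrD; ring.
Qed.

Lemma iter_tail_sumS1_rat (n k : nat) : (k.*2 <= n)%N ->
  iter k (@tail_sumS rat) (fun=> 1) (n - k.*2)%N =
  'C(n, k)%:R * ((n%:R - 2 * k%:R + 1) / (n%:R - k%:R + 1)).
Proof.
case: k => [|k] le_kn.
  by rewrite bin0 mulr0n mulr0 !subr0 mul1r divff // natr1 pnatr_eq0.
rewrite iter_tail_sumS1 subnK //.
have E : (n%:R - k.+1%:R + 1 : rat) = (n - k)%:R.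
  by rewrite natrB; [rewrite -natr1; ring | lia].
have nz : (n%:R - k.+1%:R + 1 : rat) != 0 by rewrite E pnatr_eq0; lia.
(* This ratio of neighbouring binomials turns the difference into the product form. *)
have : (k.+1 * 'C(n, k.+1))%:R = ((n - k) * 'C(n, k))%:R :> rat.
  by rewrite mul_bin_left.
rewrite !natrM -E => B.
apply: (mulIf nz); rewrite mulrBl [X in _ - X]mulrC -B; field.
by rewrite nat1r.
Qed.

(** The weights are [x_j = q^j t], with [q] the inner variable and [t] the outer one, so the power
    of [t] counts descents. *)
Lemma coef_prod_Des (n : nat) (D : {set 'I_n}) (i : nat) :
  (\prod_(j in D) (('X^j)%:P * 'X) : {poly {poly rat}})`_i =
  if #|D| == i then 'X^(\sum_(j in D) j) else 0.
Proof.
rewrite big_split /= prodr_const -rmorph_prod /= prodrXr coefCM coefXn eq_sym.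
by case: eqP; rewrite ?mulr1 ?mulr0.
Qed.

(** The ballot numbers are constant in [t], so they pass through the extraction of a coefficient. *)
Lemma tail_sumS_polyC (R : comNzRingType) k h :
  iter k (@tail_sumS {poly R}) (fun=> 1) h = (iter k (@tail_sumS R) (fun=> 1) h)%:P.
Proof.
elim: k h => [//|k IH] h; rewrite !iterS /tail_sumS /tail_sum rmorph_sum.
by apply: eq_bigr => j _; rewrite IH.
Qed.

Theorem lemma1 (n i : nat) (hn : (1 <= n)%N) (hi : (i <= n./2)%N) :
  A_poly n i =
  \sum_(i <= k < (n./2).+1)
     (('C(n, k)%:R * ((n%:R - 2 * k%:R + 1) / (n%:R - k%:R + 1)) : rat)
        *: f_poly n [:: (n - k)%N; k] i).
Proof.
case: n hn hi => // n' _ hi; set n := n'.+1 in hi *.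
pose x j : {poly {poly rat}} := ('X^j)%:P * 'X.
transitivity ((\sum_(s in S321 n) perm_wt x s)`_i).
  rewrite coef_sum /A_poly big_mkcondr; apply: eq_bigr => s _.
  by rewrite coef_prod_Des.
rewrite perm_wt_sum_SYT coef_sum.
transitivity (\sum_(0 <= k < (n./2).+1)
     (('C(n, k)%:R * ((n%:R - 2 * k%:R + 1) / (n%:R - k%:R + 1)) : rat)
        *: f_poly n [:: (n - k)%N; k] i)).
  rewrite big_mkord; apply: eq_bigr => k _.
  rewrite !tail_sumS_polyC coefCM iter_tail_sumS1_rat; last first.
    by have := ltn_ord k; lia.
  rewrite mul_polyC coef_sum /f_poly big_mkcondr; congr (_ *: _).
  by apply: eq_bigr => T _; rewrite coef_prod_Des.
(* The terms with [k < i] vanish, since a second row of length [k] allows at most [k] descents. *)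
rewrite (big_cat_nat (n := i)) //=; last by lia.
rewrite big_nat big1 ?add0r // => k /andP[_ lt_ki].
rewrite /f_poly big1 ?scaler0 // => T /andP[HT /eqP E].
have le_k : (k.*2 <= n)%N by lia.
by have := leq_tab_des le_k HT; rewrite E leqNgt lt_ki.
Qed.
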